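(* Let $\mathbf A$ be a finite solvable algebra with a Malcev term. Then there is a finite sequence of primes $p_1,\dots,p_h$ such that $\mathrm{nuP}_{\mathbf A}\subseteq\mathsf{nuDet}_{p_1}\circ\cdots\circ\mathsf{nuDet}_{p_h}$.
   Context: A finite algebra has finite universe and finitely many basic operations. An $n$-ary circuit over $\mathbf A$ is a DAG with one output node, sources labelled by variables or constants from $A$, gates labelled by basic operations; size is nodes plus edges. A NuDFA over $\mathbf A$ is $(\{t_n\}_{n\ge1},\iota,S)$ with $t_n$ an $n$-ary circuit, $\iota:\{0,1\}\to A$, $S\subseteq A$, accepting $b\in\{0,1\}^n$ iff $t_n(\iota(b_1),\dots,\iota(b_n))\in S$; polynomial size means size of $t_n$ polynomial in $n$; $\mathrm{nuP}_{\mathbf A}$ is the class of languages over $\{0,1\}$ accepted by polynomial-size NuDFAs over $\mathbf A$. A Malcev term is a ternary term $d$ with $d(x,y,y)=d(y,y,x)=x$; solvability is in the sense of commutator theory. An ABP over $\mathrm{GF}(p)$ is a directed acyclic multigraph with one source and one sink, edges labelled by variables or constants of $\mathrm{GF}(p)$; it computes the sum over source–sink paths of the products of labels; size is vertices plus edges. A $\mathrm{BABP}_p$ gate is labelled by an ABP over $\mathrm{GF}(p)$ and $T\subseteq\mathrm{GF}(p)$ and outputs 1 on Boolean inputs iff the polynomial value lies in $T$; its size is the ABP's size. $\mathsf{nuDet}_{p_1}\circ\cdots\circ\mathsf{nuDet}_{p_h}$ is the class of languages $L\subseteq\{0,1\}^*$ such that for each $n$, $L\cap\{0,1\}^n$ is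 recognized by a layered circuit whose top layer is a single $\mathrm{BABP}_{p_1}$ gate, whose layer $i$ consists of $\mathrm{BABP}_{p_i}$ gates taking inputs from layer $i+1$, and whose bottom layer of $\mathrm{BABP}_{p_h}$ gates reads the input bits, of total size (edges plus sum of gate sizes) polynomial in $n$. *)

(* Defs.v *)
From HB Require Import structures.
From mathcomp Require Import all_boot all_order all_algebra.
Set Implicit Arguments. Unset Strict Implicit. Unset Printing Implicit Defensive.
Import GRing.Theory.

Record finAlgebra := FinAlgebra {
  carrier : finType;
  nops : nat;
  arity : 'I_nops -> nat;
  op : forall i : 'I_nops, {ffun 'I_(arity i) -> carrier} -> carrier }.

Inductive term (A : finAlgebra) (V : Type) : Type :=
| TVar of V
| TApp (i : 'I_(nops A)) of ('I_(arity i) -> term A V).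

Fixpoint teval (A : finAlgebra) (V : Type) (env : V -> carrier A) (t : term A V)
  : carrier A :=
  match t with
  | TVar v => env v
  | TApp i f => op [ffun j => teval env (f j)]
  end.

Definition has_malcev_term (A : finAlgebra) : Prop :=
  exists d : term A 'I_3, forall x y : carrier A,
    teval (fun v : 'I_3 => nth x [:: x; y; y] v) d = x /\
    teval (fun v : 'I_3 => nth x [:: y; y; x] v) d = x.

Definition relA (A : finAlgebra) := carrier A -> carrier A -> Prop.

Definition congruence (A : finAlgebra) (th : relA A) : Prop :=
  (forall x, th x x) /\ (forall x y, th x y -> th y x) /\
  (forall x y z, th x y -> th y z -> th x z) /\
  (forall (i : 'I_(nops A)) (f g : {ffun 'I_(arity i) -> carrier A}),
      (forall j, th (f j) (g j)) -> th (op f) (op g)).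

Definition centralizes (A : finAlgebra) (alpha beta delta : relA A) : Prop :=
  forall (m l : nat) (t : term A ('I_m + 'I_l)%type)
         (a a' : 'I_m -> carrier A) (b b' : 'I_l -> carrier A),
    (forall i, alpha (a i) (a' i)) -> (forall j, beta (b j) (b' j)) ->
    let ev u v := teval (fun w => match w with inl i => u i | inr j => v j end) t in
    delta (ev a b) (ev a b') -> delta (ev a' b) (ev a' b').

Definition is_commutator (A : finAlgebra) (alpha beta gamma : relA A) : Prop :=
  congruence gamma /\ centralizes alpha beta gamma /\
  (forall delta, congruence delta -> centralizes alpha beta delta ->
     forall x y, gamma x y -> delta x y).

Definition solvable_algebra (A : finAlgebra) : Prop :=
  exists (k : nat) (s : nat -> relA A),
    (forall x y, s 0%N x y) /\
    (forall i, (i < k)%N -> is_commutator (s i) (s i) (s i.+1)) /\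
    (forall x y, s k x y -> x = y).

(* Circuits over A.  Nodes are numbered in a topological order; a gate *)
(* at position m may only read nodes 0..m-1; the last node is the     *)
(* output.                                                             *)
Inductive cgate (A : finAlgebra) (n m : nat) : Type :=
| CVar of 'I_n
| CConst of carrier A
| COp (i : 'I_(nops A)) of ('I_(arity i) -> 'I_m).

Inductive circ (A : finAlgebra) (n : nat) : nat -> Type :=
| cnil : circ A n 0
| csnoc (m : nat) of circ A n m & cgate A n m : circ A n m.+1.

Definition geval (A : finAlgebra) (n m : nat) (x : 'I_n -> carrier A)
  (v : m.-tuple (carrier A)) (g : cgate A n m) : carrier A :=
  match g with
  | CVar j => x j
  | CConst a => a
  | COp i args => op [ffun j => tnth v (args j)]
  end.

Fixpoint cvals (A : finAlgebra) (n m : nat) (c : circ A n m) (x : 'I_n -> carrier A)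
  : m.-tuple (carrier A) :=
  match c in circ _ _ m return m.-tuple (carrier A) with
  | cnil => [tuple]
  | csnoc m' c' g => let v := cvals c' x in [tuple of rcons v (geval x v g)]
  end.

Definition cgate_edges (A : finAlgebra) (n m : nat) (g : cgate A n m) : nat :=
  match g with COp i _ => arity i | _ => 0%N end.

Fixpoint circ_edges (A : finAlgebra) (n m : nat) (c : circ A n m) : nat :=
  match c with
  | cnil => 0%N
  | csnoc _ c' g => (circ_edges c' + cgate_edges g)%N
  end.

Record circuit (A : finAlgebra) (n : nat) := Circuit {
  cnodes : nat;
  cbody : circ A n cnodes.+1 }.

Definition circuit_eval (A : finAlgebra) (n : nat) (t : circuit A n)
  (x : 'I_n -> carrier A) : carrier A :=
  tnth (cvals (cbody t) x) ord_max.

Definition circuit_size (A : finAlgebra) (n : nat) (t : circuit A n) : nat :=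
  (cnodes t).+1 + circ_edges (cbody t).

Definition language := seq bool -> Prop.

Definition nudfa_accepts (A : finAlgebra) (t : forall n, circuit A n)
  (iota : bool -> carrier A) (S : {set carrier A}) (w : seq bool) : Prop :=
  (0 < size w)%N /\
  circuit_eval (t (size w)) (fun j => iota (nth false w j)) \in S.

Definition nuP (A : finAlgebra) (L : language) : Prop :=
  exists (t : forall n, circuit A n) (iota : bool -> carrier A) (S : {set carrier A}),
    (exists c : nat, forall n, (0 < n)%N -> (circuit_size (t n) <= c * n ^ c + c)%N) /\
    (forall w, L w <-> nudfa_accepts t iota S w).

(* Algebraic branching programs over GF(p) = 'F_p in k variables.     *)
(* Vertices 'I_(nv.+2) in topological order (every edge goes from a   *)
(* smaller to a larger vertex); source = 0, sink = nv.+1.             *)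
Inductive abp_label (p k : nat) : Type :=
| LVar of 'I_k
| LConst of 'F_p.

Record abp (p k : nat) := ABP {
  abp_nv : nat;
  abp_ne : nat;
  abp_src : 'I_abp_ne -> 'I_abp_nv.+2;
  abp_tgt : 'I_abp_ne -> 'I_abp_nv.+2;
  abp_lab : 'I_abp_ne -> abp_label p k;
  abp_acyclic : forall e, (abp_src e < abp_tgt e)%N }.

Definition label_val (p k : nat) (x : 'I_k -> bool) (l : abp_label p k) : 'F_p :=
  match l with LVar j => ((x j)%:R)%R | LConst c => c end.

Definition st_path (p k : nat) (B : abp p k) (s : seq 'I_(abp_ne B)) : bool :=
  match s with
  | [::] => false
  | e :: s' => [&& abp_src e == ord0, abp_tgt (last e s') == ord_max &
                  path (fun e1 e2 => abp_tgt e1 == abp_src e2) e s']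
  end.

(* sum over source-sink paths of the products of the labels
   (paths have at most abp_ne edges since vertices strictly increase) *)
Definition abp_value (p k : nat) (B : abp p k) (x : 'I_k -> bool) : 'F_p :=
  (\sum_(r < (abp_ne B).+1) \sum_(s : r.-tuple 'I_(abp_ne B) | @st_path p k B s)
     \prod_(e <- s) label_val x (@abp_lab p k B e))%R.

Definition abp_size (p k : nat) (B : abp p k) : nat := (abp_nv B).+2 + abp_ne B.

(* A BABP_p gate with fan-in bfanin, reading the wires bwire (indices in the
   layer below / input bits), labelled by an ABP and T = bset. *)
Record bgate (p : nat) := BGate {
  bfanin : nat;
  bwire : 'I_bfanin -> nat;
  babp : abp p bfanin;
  bset : {set 'F_p} }.

Definition bgate_out (p : nat) (g : bgate p) (y : nat -> bool) : bool :=
  abp_value (babp g) (fun e => y (@bwire p g e)) \in bset g.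

(* Layered circuit for primes ps = [:: p_1; ...; p_h] with n inputs.
   Layers are numbered from the bottom: layer l (0 <= l < h) consists of
   BABP_{p_(h-l)} gates; layer 0 reads the input bits, layer l+1 reads
   layer l; the top layer h-1 consists of a single gate. *)
Record lcircuit (ps : seq nat) (n : nat) := LCircuit {
  lwidth : nat -> nat;
  lgate : forall l j : nat, bgate (nth 0%N (rev ps) l);
  ltop : lwidth (size ps).-1 = 1%N;
  lwf : forall l j, (l < size ps)%N -> (j < lwidth l)%N ->
          forall e, (@bwire _ (lgate l j) e < (if l is l'.+1 then lwidth l' else n))%N }.

Fixpoint lval (ps : seq nat) (n : nat) (C : lcircuit ps n) (x : nat -> bool)
  (l : nat) : nat -> bool :=
  match l with
  | 0 => fun j => bgate_out (lgate C 0 j) x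
  | l'.+1 => fun j => bgate_out (lgate C l'.+1 j) (lval C x l')
  end.

Definition lout (ps : seq nat) (n : nat) (C : lcircuit ps n) (w : seq bool) : bool :=
  lval C (fun q => nth false w q) (size ps).-1 0%N.

Definition lsize (ps : seq nat) (n : nat) (C : lcircuit ps n) : nat :=
  \sum_(l < size ps) \sum_(j < lwidth C l)
     (bfanin (lgate C l j) + abp_size (babp (lgate C l j))).

Definition nuDet (ps : seq nat) (L : language) : Prop :=
  exists c : nat, forall n : nat, exists C : lcircuit ps n,
    (lsize C <= c * n ^ c + c)%N /\
    (forall w, size w = n -> (L w <-> lout C w)).

(* Main.v *)
Require Import Defs.
From HB Require Import structures.
From mathcomp Require Import all_boot all_order all_algebra all_fingroup all_solvable.
From mathcomp Require Import boolp zify.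
Set Implicit Arguments. Unset Strict Implicit. Unset Printing Implicit Defensive.
Import GRing.Theory.

(** Let [th] be a congruence, known on every node of a circuit, i.e. some Boolean gates
    tell in which [th]-block the value of each node lies.  Call a function [f] from the
    algebra to GF(p) good on a block if, hereditarily, composing it with a basic operation
    gives a sum of functions of the single arguments, as long as these stay in fixed
    blocks.  Then [f (value of v)] is obtained from the values of good functions at the
    predecessors of [v] by linear forms whose coefficients are polynomials in the block
    bits, so an ABP over GF(p) along the circuit computes it, and one layer of gates
    yields the refinement of [th] by the level sets of all good functions.  This
    refinement is again a congruence.  It is strict for some prime p as long as [th] is not
    equality: choose i with th <= s_i, not th <= s_(i+1) in the derived series; modulo
    s_(i+1) the Malcev term commutes with all operations on [th]-blocks and makes some
    block a nontrivial finite abelian group, and a nontrivial homomorphism to GF(p) is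
    good.  After finitely many layers the values of all nodes are known, and a last gate
    tests whether the output lies in the accepting set. *)

(** * Values of algebraic branching programs *)

Lemma sum_tuple_cons (R : nmodType) (T : finType) (r : nat) (P : pred (seq T))
    (F : seq T -> R) :
  (\sum_(s : r.+1.-tuple T | P s) F s =
   \sum_(e : T) \sum_(s : r.-tuple T | P (e :: s)) F (e :: s))%R.
Proof.
rewrite pair_big_dep /=.
rewrite (reindex (fun q : T * r.-tuple T => [tuple of q.1 :: q.2])) //=.
exists (fun s : r.+1.-tuple T => (thead s, [tuple of behead s])).
  by move=> [e s] _ /=; congr pair; apply: val_inj.
by move=> s _ /=; apply: val_inj; rewrite /= [in RHS](tuple_eta s).
Qed.

Section AbpValue.
Variables (p k : nat) (B : abp p k) (x : 'I_k -> bool).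
Local Notation edge := 'I_(abp_ne B).
Local Notation src := (@abp_src p k B).
Local Notation tgt := (@abp_tgt p k B).
Local Notation lab e := (label_val x (@abp_lab p k B e)).
Local Open Scope ring_scope.

Let sink_path (s : seq edge) : bool :=
  if s is e :: s' then
    (tgt (last e s') == ord_max) && path (fun e1 e2 => tgt e1 == src e2) e s'
  else false.

Let start (s : seq edge) := if s is e :: _ then src e else ord0.

Let weight (s : seq edge) : 'F_p := \prod_(e <- s) lab e.

(** Targets strictly increase along a path, so no edge repeats. *)
Lemma sink_path_size (s : seq edge) : sink_path s -> (size s <= abp_ne B)%N.
Proof.
case: s => // e s /= /andP[_ hp].
have hs : sorted (fun e1 e2 => tgt e1 < tgt e2)%N (e :: s).
  apply: sub_path hp => e1 e2 /eqP ->; exact: abp_acyclic.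
have hu : uniq (e :: s).
  apply: (sorted_uniq _ _ hs); first by move=> ? ? ?; apply: ltn_trans.
  by move=> ?; rewrite /= ltnn.
by have := max_card (mem (e :: s)); rewrite card_ord (card_uniqP hu).
Qed.

(** The recursion for [g] is unfolded at the start of the paths into the sink: the paths starting at
    the source split off, the others grow by one edge, until no path is long enough. *)
Lemma abp_valueE (g : 'I_(abp_nv B).+2 -> 'F_p) :
  g ord0 = 1 ->
  (forall v, v != ord0 -> g v = \sum_(e | tgt e == v) lab e * g (src e)) ->
  abp_value B x = g ord_max.
Proof.
move=> g0 gS.
have gE v : g v = (v == ord0)%:R + \sum_(e | tgt e == v) lab e * g (src e).
  have [->|nv] := eqVneq v ord0; last by rewrite add0r gS.
  rewrite g0 big_pred0 ?addr0 // => e; apply/negbTE/eqP => h.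
  by have := abp_acyclic e; rewrite h ltn0.
pose E r := \sum_(s : r.+1.-tuple edge | sink_path s) weight s * g (start s).
pose SP r := \sum_(s : r.-tuple edge | @st_path p k B s) weight s.
have ES r : E r = SP r.+1 + E r.+1.
  have Econs : E r.+1 = \sum_e \sum_(s : r.+1.-tuple edge | sink_path s)
      if tgt e == start s then weight (e :: s) * g (src e) else 0.
    rewrite /E (sum_tuple_cons _ sink_path (fun s => weight s * g (start s))).
    apply: eq_bigr => e _; rewrite -big_mkcondr; apply: eq_bigl.
    by move=> [[//|e1 s] hs] /=; rewrite -andbA; congr andb; rewrite andbC.
  rewrite Econs exchange_big /SP /= (eq_bigl (fun s : r.+1.-tuple edge => sink_path s && (start s == ord0))); last first.
    by move=> [[//|e1 s] hs] /=; rewrite andbC.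
  rewrite big_mkcondr -big_split /=; apply: eq_bigr => s _.
  rewrite gE mulrDr; congr (_ + _); first by case: ifP; rewrite ?mulr1 ?mulr0.
  rewrite mulr_sumr -big_mkcond /=.
  by apply: eq_big => // e _; rewrite /weight big_cons mulrCA mulrA.
have E0 : E 0%N = g ord_max.
  rewrite /E (sum_tuple_cons _ sink_path (fun s => weight s * g (start s))) gE add0r.
  rewrite [RHS]big_mkcond; apply: eq_bigr => e _ /=.
  rewrite (eq_bigl (fun s : 0.-tuple edge => (s == [tuple]) && (tgt e == ord_max))); last first.
    by move=> s; rewrite [s]tuple0 /= andbT.
  rewrite big_mkcondr big_pred1_eq; case: ifP => // _.
  by rewrite /weight big_seq1.
have telescope R : E 0%N = \sum_(r < R) SP r.+1 + E R.
  elim: R => [|R ->]; first by rewrite big_ord0 add0r.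
  by rewrite big_ord_recr -addrA -ES.
rewrite -E0 (telescope (abp_ne B)) /abp_value big_ord_recl.
rewrite big_pred0; last by move=> s; rewrite [s]tuple0.
rewrite add0r [E (abp_ne B)]big_pred0 ?addr0 // => s.
by apply: contraTF (leqnn (abp_ne B).+1) => /sink_path_size; rewrite size_tuple ltnn.
Qed.

End AbpValue.

(** * Straight-line programs for branching programs *)

Definition gate_size p (g : bgate p) : nat := (bfanin g + abp_size (babp g))%N.

Section Programs.
Variables (p N : nat).
Local Open Scope ring_scope.
Local Notation F := 'F_p.

(* The instruction [((l1, s1), (l2, s2))] appends the vertex of value
   [l1 * v_s1 + l2 * v_s2]; vertex 0 has value 1. *)
Definition instr := ((abp_label p N * nat) * (abp_label p N * nat))%type.
Definition program := seq instr.

Definition instr_val (y : 'I_N -> bool) (vs : seq F) (q : instr) : F :=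
  label_val y q.1.1 * vs`_(q.1.2) + label_val y q.2.1 * vs`_(q.2.2).

Definition run (y : 'I_N -> bool) (P : program) : seq F :=
  foldl (fun vs q => rcons vs (instr_val y vs q)) [:: 1] P.

Definition vertex_val y P i : F := (run y P)`_i.

Lemma run_rcons y P q : run y (rcons P q) = rcons (run y P) (instr_val y (run y P) q).
Proof. by rewrite /run -cats1 foldl_cat. Qed.

Lemma size_run y P : size (run y P) = (size P).+1.
Proof. by elim/last_ind: P => // P q IH; rewrite run_rcons !size_rcons IH. Qed.

Lemma vertex_val_cat y P Q i : (i <= size P)%N ->
  vertex_val y (P ++ Q) i = vertex_val y P i.
Proof.
elim/last_ind: Q => [|Q q IH] le_i; first by rewrite cats0.
rewrite /vertex_val -rcons_cat run_rcons nth_rcons size_run size_cat.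
by rewrite ltnS (leq_trans le_i) ?leq_addr //; exact: IH.
Qed.

Lemma vertex_val_last y P q :
  vertex_val y (rcons P q) (size P).+1 = instr_val y (run y P) q.
Proof. by rewrite /vertex_val run_rcons nth_rcons size_run ltnn eqxx. Qed.

(** An instruction sees only the vertices appended before it; a later index reads the default 0 of
    [nth], not the final value of that vertex. *)
Lemma vertex_valS y P i : (i < size P)%N ->
  let q := nth ((LConst N 0, 0%N), (LConst N 0, 0%N)) P i in
  let v j := if (j <= i)%N then vertex_val y P j else 0 in
  vertex_val y P i.+1 = label_val y q.1.1 * v q.1.2 + label_val y q.2.1 * v q.2.2.
Proof.
move=> lt_i q v.
have defP : P = rcons (take i P) q ++ drop i.+1 P.
  by rewrite -(take_nth _ lt_i) cat_take_drop.
have sz : size (take i P) = i by rewrite size_take lt_i.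
rewrite {1}defP vertex_val_cat; last by rewrite size_rcons sz.
rewrite -[in i.+1]sz vertex_val_last /instr_val.
have vE j : (run y (take i P))`_j = v j.
  rewrite /v; case: leqP => h; last by rewrite nth_default // size_run sz.
  rewrite -[in RHS](cat_take_drop i P).
  by rewrite vertex_val_cat // sz.
by rewrite !vE.
Qed.

(* Sources that are not earlier vertices, whose value is 0 by convention, are redirected to
   vertex 0 along an edge labelled 0. *)
Section ProgramAbp.
Variable P : program.
Hypothesis P_gt0 : (0 < size P)%N.
(** An [abp] has [nv.+2] vertices, the program [size P + 1]. Each instruction gives two edges into
    its vertex, told apart by a Boolean. *)
Let nv := (size P).-1.
Local Notation edges := ('I_(size P) * bool)%type.

Let edge_instr (e : edges) : abp_label p N * nat :=
  let q := nth ((LConst N 0, 0%N), (LConst N 0, 0%N)) P e.1 in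
  if e.2 then q.1 else q.2.

Let edge_src (e : edges) : 'I_nv.+2 :=
  if ((edge_instr e).2 <= e.1)%N then inord (edge_instr e).2 else ord0.
Let edge_tgt (e : edges) : 'I_nv.+2 := inord e.1.+1.
Let edge_lab (e : edges) : abp_label p N :=
  if ((edge_instr e).2 <= e.1)%N then (edge_instr e).1 else LConst N 0.

Let szP : nv.+1 = size P. Proof. by rewrite prednK. Qed.

Lemma edge_acyclic (e : edges) : (edge_src e < edge_tgt e)%N.
Proof.
rewrite /edge_src /edge_tgt inordK; last by rewrite ltnS szP ltn_ord.
case: ifP => // h; rewrite inordK ?ltnS //.
by rewrite (leq_trans h) // szP ltnW.
Qed.

Definition program_abp : abp p N :=
  @ABP p N nv #|{: edges}| (fun e => edge_src (enum_val e))
    (fun e => edge_tgt (enum_val e)) (fun e => edge_lab (enum_val e))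
    (fun e => edge_acyclic (enum_val e)).

Lemma program_abp_size : abp_size program_abp = (3 * size P).+1.
Proof. rewrite /abp_size /= card_prod card_ord card_bool; lia. Qed.

Lemma program_abp_value (y : 'I_N -> bool) :
  abp_value program_abp y = vertex_val y P (size P).
Proof.
pose g (v : 'I_nv.+2) := vertex_val y P v.
rewrite (abp_valueE (B := program_abp) (g := g)) /g //=; first by rewrite szP.
  by rewrite -[P]cat0s vertex_val_cat.
move=> [[//|i] hi] _.
have lt_i : (i < size P)%N by rewrite -szP.
rewrite vertex_valS //=.
rewrite (reindex_onto (@enum_rank edges) enum_val) /=; last by move=> *; rewrite enum_valK.
rewrite (eq_bigl (fun e : edges => e.1 == Ordinal lt_i)); last first.
  move=> e; rewrite enum_rankK eqxx andbT -!val_eqE /edge_tgt /= inordK //.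
  by rewrite ltnS szP.
rewrite (eq_bigr (fun e : edges => label_val y (edge_instr e).1 *
   (if ((edge_instr e).2 <= e.1)%N then vertex_val y P (edge_instr e).2 else 0))); last first.
  move=> e _; rewrite enum_rankK /edge_lab /edge_src.
  case: ifP => h; last by rewrite mul0r mulr0.
  by rewrite inordK // ltnS (leq_trans h) // szP ltnW.
transitivity (\sum_(a | a == Ordinal lt_i) \sum_(b : bool)
    label_val y (edge_instr (a, b)).1 *
   (if ((edge_instr (a, b)).2 <= a)%N then vertex_val y P (edge_instr (a, b)).2 else 0)).
  by rewrite big_pred1_eq big_bool.
by rewrite pair_big_dep; apply: eq_big => [[a b]|[a b] _] //=; rewrite andbT.
Qed.

End ProgramAbp.

Definition prod_term := (F * seq 'I_N * nat)%type.
Definition term_val (y : 'I_N -> bool) P (t : prod_term) : F :=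
  t.1.1 * (\prod_(k <- t.1.2) (y k)%:R) * vertex_val y P t.2.

Lemma extend_monomial P i (m : seq 'I_N) : (i <= size P)%N ->
  exists Q, size Q = (size m).+1 /\
    forall y, vertex_val y (P ++ Q) (size (P ++ Q)) =
      (\prod_(k <- m) (y k)%:R) * vertex_val y P i.
Proof.
move=> le_i; elim: m => [|k m [Q [sQ vQ]]].
  exists [:: ((LConst N 1, i), (LConst N 0, 0%N))]; split=> // y.
  rewrite cats1 size_rcons vertex_val_last /instr_val /= mul0r addr0.
  by rewrite big_nil.
exists (rcons Q ((LVar p k, size (P ++ Q)), (LConst N 0, 0%N))).
split; first by rewrite size_rcons sQ.
move=> y; rewrite -rcons_cat size_rcons vertex_val_last /instr_val /= mul0r addr0.
by rewrite -/(vertex_val _ _ _) vQ big_cons mulrA.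
Qed.

(** A term costs at most [s + 1] instructions for its monomial and one more that adds it to the
    running sum, with its coefficient as an edge label. *)
Lemma extend_sum P (s : nat) (L : seq prod_term) :
  all (fun t => (size t.1.2 <= s) && (t.2 <= size P))%N L ->
  exists Q, [/\ (0 < size Q)%N, (size Q <= (s + 2) * size L + 1)%N &
    forall y, vertex_val y (P ++ Q) (size (P ++ Q)) = \sum_(t <- L) term_val y P t].
Proof.
elim: L => [_|t L IH /= /andP[/andP[hs hi] /IH[Q [Q0 sQ vQ]]]].
  (* This instruction of value 0 serves the empty sum and makes the program nonempty, as
     [program_abp] requires. *)
  exists [:: ((LConst N 0, 0%N), (LConst N 0, 0%N))]; split=> [||y] //; first by rewrite /=; lia.
  by rewrite cats1 size_rcons vertex_val_last /instr_val /= !mul0r addr0 big_nil.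
have [|Q2 [sQ2 vQ2]] := @extend_monomial (P ++ Q) t.2 t.1.2.
  by rewrite size_cat (leq_trans hi) // leq_addr.
exists (rcons (Q ++ Q2) ((LConst N t.1.1, size ((P ++ Q) ++ Q2)), (LConst N 1, size (P ++ Q)))).
split; first by rewrite size_rcons.
  rewrite size_rcons size_cat sQ2; lia.
move=> y; rewrite -rcons_cat size_rcons vertex_val_last /instr_val /= mul1r.
rewrite catA -!/(vertex_val _ _ _) vQ2 (vertex_val_cat y (P := P ++ Q)) // vQ.
rewrite vertex_val_cat //.
by rewrite big_cons /term_val mulrA.
Qed.

(** The terms refer to vertices of [P] alone, so the sums can be appended one after another without
    disturbing each other. *)
Lemma extend_family P (s l : nat) (K : finType) (L : K -> seq prod_term) :
  (forall k, all (fun t => (size t.1.2 <= s) && (t.2 <= size P))%N (L k)) ->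
  (forall k, size (L k) <= l)%N ->
  exists Q (ix : K -> nat),
    (size Q <= #|K| * ((s + 2) * l + 1))%N /\
    forall k, (ix k <= size (P ++ Q))%N /\
      forall y, vertex_val y (P ++ Q) (ix k) = \sum_(t <- L k) term_val y P t.
Proof.
move=> hL hl.
suff [Q [ix [sQ hQ]]] : exists Q (ix : K -> nat),
    (size Q <= size (enum K) * ((s + 2) * l + 1))%N /\
    forall k, k \in enum K -> (ix k <= size (P ++ Q))%N /\
      forall y, vertex_val y (P ++ Q) (ix k) = \sum_(t <- L k) term_val y P t.
  by exists Q, ix; rewrite cardE; split=> // k; apply: hQ; rewrite mem_enum.
elim: (enum K) => [|k r [Q [ix [sQ hQ]]]]; first by exists [::], (fun _ => 0%N).
have [|Q2 [_ sQ2 vQ2]] := @extend_sum (P ++ Q) s (L k).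
  apply: sub_all (hL k) => t /andP[-> /leq_trans-> //].
  by rewrite size_cat leq_addr.
exists (Q ++ Q2), (fun j => if j == k then size ((P ++ Q) ++ Q2) else ix j).
split.
  rewrite size_cat /= mulSn addnC; apply: leq_add => //; apply: leq_trans sQ2 _.
  by rewrite leq_add2r leq_mul2l hl orbT.
move=> j; rewrite inE catA; case: eqP => [-> _|_ /= /hQ[h1 h2]].
  split=> // y; rewrite vQ2 !big_seq; apply: eq_bigr => t tL.
  rewrite /term_val vertex_val_cat //.
  by have /allP/(_ _ tL)/andP[] := hL k.
split=> [|y]; first by rewrite size_cat (leq_trans h1) // leq_addr.
by rewrite vertex_val_cat.
Qed.

Definition program_gate P (P_gt0 : (0 < size P)%N) (T : {set F}) : bgate p :=
  @BGate p N (fun e => e) (program_abp P_gt0) T.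

Lemma gate_of_sum P (s : nat) (L : seq prod_term) (T : {set F}) :
  all (fun t => (size t.1.2 <= s) && (t.2 <= size P))%N L ->
  exists g : bgate p, [/\ forall e, (bwire (b := g) e < N)%N,
    (gate_size g <= N + 3 * (size P + (s + 2) * size L + 1) + 1)%N &
    forall y : nat -> bool, bgate_out g y =
       (\sum_(t <- L) term_val (fun e : 'I_N => y e) P t \in T)].
Proof.
move=> /extend_sum[Q [Q0 sQ vQ]].
have PQ0 : (0 < size (P ++ Q))%N by rewrite size_cat addn_gt0 Q0 orbT.
exists (program_gate PQ0 T); split=> [e||y]; first exact: ltn_ord.
  rewrite /gate_size [babp _]/= [bfanin _]/= program_abp_size size_cat; lia.
by rewrite /bgate_out /= program_abp_value vQ.
Qed.

End Programs.

(** * Characters of finite abelian groups *)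

(** A normal subgroup of prime index has a cyclic quotient; an element is sent to the exponent of
    its coset over a fixed generator, read in GF(p). *)
Lemma abelian_group_character (gT : finGroupType) :
  abelian [set: gT] -> (1 < #|gT|)%N ->
  exists (p : nat) (f : gT -> 'F_p),
    [/\ prime p, forall x y, f (x * y)%g = (f x + f y)%R & exists x, f x <> 0%R].
Proof.
move=> abT ntT.
have nt : [set: gT] != 1%g by rewrite trivg_card1 cardsT neq_ltn ntT orbT.
have [H nH pH] := sol_prime_factor_exists (abelian_sol abT) nt.
set p := #|_ : _|%g in pH.
have cardQ : #|([set: gT] / H)%g| = p by rewrite card_quotient ?normal_norm.
have /cyclicP[z Qz] : cyclic ([set: gT] / H)%g by rewrite prime_cyclic // cardQ.
have oz : #[z]%g = p by rewrite -cardQ Qz.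
have inN x : x \in 'N(H)%g by apply: (subsetP (normal_norm nH)); rewrite inE.
have ex x : exists i, coset H x == (z ^+ i)%g.
  have : coset H x \in <[z]>%g by rewrite -Qz mem_quotient // inE.
  by case/cycleP=> i ->; exists i.
pose f x : 'F_p := (xchoose (ex x))%:R%R.
have fE x i : coset H x = (z ^+ i)%g -> f x = i%:R%R.
  move=> xi; have /eqP/esym := xchooseP (ex x); rewrite -/(f x).
  rewrite [RHS]xi => /eqP; rewrite eq_expg_mod_order oz => /eqP h.
  rewrite /f -(GRing.natr_mod_pchar (pchar_Fp pH)) -[RHS](GRing.natr_mod_pchar (pchar_Fp pH)).
  by rewrite h.
exists p, f; split=> //.
  move=> x y; rewrite (fE (x * y)%g (xchoose (ex x) + xchoose (ex y))%N) ?natrD //.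
  by rewrite morphM // expgD -(eqP (xchooseP (ex x))) -(eqP (xchooseP (ex y))).
have : z \in ([set: gT] / H)%g by rewrite Qz cycle_id.
case/morphimP=> x _ _ xz; exists x; rewrite (fE x 1%N) //; exact/eqP/oner_neq0.
Qed.

Section CharacterOfLaws.
Variables (T : finType) (mul : T -> T -> T) (one : T) (inv : T -> T).
Hypotheses (mulA : associative mul) (mul1 : left_id one mul)
  (mulC : commutative mul) (mulV : left_inverse one inv mul).

(** An alias of [T] indexed by proofs of the laws, to which a group structure can be attached. *)
Definition carrier_of_laws of associative mul & left_id one mul &
  left_inverse one inv mul : Type := T.
Local Notation G := (carrier_of_laws mulA mul1 mulV).
HB.instance Definition _ := Finite.on G.
HB.instance Definition _ := Finite_isGroup.Build G mulA mul1 mulV.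

Lemma character_of_laws (x0 : T) : x0 <> one ->
  exists (p : nat) (f : T -> 'F_p),
    [/\ prime p, forall x y, f (mul x y) = (f x + f y)%R & exists x, f x <> 0%R].
Proof.
move=> ne; apply: (@abelian_group_character G).
  by apply/centsP => x _ y _; apply: mulC.
by apply/card_gt1P; exists x0, one; split=> //; apply/eqP.
Qed.
End CharacterOfLaws.

(** * Abelian blocks of a Malcev algebra *)

Section Terms.
Variable A : finAlgebra.
Local Notation C := (carrier A).

Fixpoint tsubst (V W : Type) (s : V -> term A W) (t : term A V) : term A W :=
  match t with
  | TVar v => s v
  | TApp i f => TApp (fun j => tsubst s (f j))
  end.

Lemma teval_subst (V W : Type) (s : V -> term A W) (env : W -> C) t :
  teval env (tsubst s t) = teval (fun v => teval env (s v)) t.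
Proof.
by elim: t => //= i f IH; congr op; apply/ffunP => j; rewrite !ffunE.
Qed.

Lemma eq_teval (V : Type) (env env' : V -> C) t :
  env =1 env' -> teval env t = teval env' t.
Proof.
move=> e; elim: t => //= i f IH; congr op; apply/ffunP => j; by rewrite !ffunE.
Qed.

Lemma congruence_teval (th : relA A) (V : Type) (env env' : V -> C) t :
  congruence th -> (forall v, th (env v) (env' v)) -> th (teval env t) (teval env' t).
Proof.
move=> [_ [_ [_ hop]]] he; elim: t => //= i f IH; apply: hop => j; by rewrite !ffunE.
Qed.

(** Renaming variables by [enum_rank] frees the term condition from ordinals, so that structured
    variable types can be used. *)
Lemma centralizes_fin (al be de : relA A) : centralizes al be de ->
  forall (V W : finType) (t : term A (V + W)) (a a' : V -> C) (b b' : W -> C),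
    (forall i, al (a i) (a' i)) -> (forall j, be (b j) (b' j)) ->
    let ev u v := teval (fun w => match w with inl i => u i | inr j => v j end) t in
    de (ev a b) (ev a b') -> de (ev a' b) (ev a' b').
Proof.
move=> cen V W t a a' b b' ha hb ev.
pose s (w : V + W) : term A ('I_#|V| + 'I_#|W|) :=
  match w with inl v => TVar A (inl (enum_rank v)) | inr v => TVar A (inr (enum_rank v)) end.
have evE u v : ev u v = teval (fun w => match w with
    inl i => u (enum_val i) | inr j => v (enum_val j) end) (tsubst s t).
  by rewrite teval_subst; apply: eq_teval => -[] w /=; rewrite enum_rankK.
by rewrite !evE; apply: cen => *.
Qed.

End Terms.

Section Malcev.
Variables (A : finAlgebra) (d : term A 'I_3).
Local Notation C := (carrier A).

Definition apply3 (x y z : C) : C := teval (fun v : 'I_3 => nth x [:: x; y; z] v) d.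
Local Notation D := apply3.

Hypotheses (Dxyy : forall x y, D x y y = x) (Dyyx : forall x y, D y y x = x).

Definition term3 (V : Type) (t1 t2 t3 : term A V) : term A V :=
  tsubst (fun v : 'I_3 => nth t1 [:: t1; t2; t3] v) d.

Lemma teval_term3 (V : Type) (env : V -> C) t1 t2 t3 :
  teval env (term3 t1 t2 t3) = D (teval env t1) (teval env t2) (teval env t3).
Proof.
by rewrite teval_subst; apply: eq_teval; case=> [[|[|[|]]]].
Qed.

Lemma congruence_apply3 (th : relA A) x y z x' y' z' : congruence th ->
  th x x' -> th y y' -> th z z' -> th (D x y z) (D x' y' z').
Proof. by move=> cth h1 h2 h3; apply: congruence_teval => //; case=> [[|[|[|]]]]. Qed.

(* The term condition is applied to
   [d (t (d X y Y)) (t (d y y Y)) (t (d y y z))], which equals [t z] for [X = y]. *)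
Lemma malcev_commutes (th ga : relA A) (V : finType) (t : term A V) (x y z : V -> C) :
  congruence th -> congruence ga -> centralizes th th ga ->
  (forall v, th (x v) (y v)) -> (forall v, th (y v) (z v)) ->
  ga (D (teval x t) (teval y t) (teval z t))
     (teval (fun v => D (x v) (y v) (z v)) t).
Proof.
move=> [rth [sth _]] [rga _] cen hxy hyz.
pose X v : term A ((V + V + V) + V) := TVar A (inl (inl (inl v))).
pose y_ v : term A ((V + V + V) + V) := TVar A (inl (inl (inr v))).
pose z_ v : term A ((V + V + V) + V) := TVar A (inl (inr v)).
pose Y v : term A ((V + V + V) + V) := TVar A (inr v).
pose Q := term3 (tsubst (fun v => term3 (X v) (y_ v) (Y v)) t)
                (tsubst (fun v => term3 (y_ v) (y_ v) (Y v)) t)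
                (tsubst (fun v => term3 (y_ v) (y_ v) (z_ v)) t).
pose a (x0 : V -> C) w := match w with
  inl (inl v) => x0 v | inl (inr v) => y v | inr v => z v end.
have QE x0 b : teval (fun w => match w with inl i => a x0 i | inr j => b j end) Q =
   D (teval (fun v => D (x0 v) (y v) (b v)) t) (teval b t) (teval z t).
  rewrite teval_term3 !teval_subst; congr apply3; apply: eq_teval => v;
  by rewrite teval_term3 /= ?Dyyx.
have := centralizes_fin cen (t := Q) (a := a y) (a' := a x) (b := y) (b' := z).
rewrite /= !QE => h.
(* At [X = x] the two sides become the values of [Q] at [Y = y] and at [Y = z]; the latter ends in
   two equal arguments, which [Dxyy] cancels. *)
have -> : teval x t = teval (fun v => D (x v) (y v) (y v)) t by apply: eq_teval => v.
rewrite -[X in ga _ X](Dxyy _ (teval z t)); apply: h => //.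
  by case=> [[]|] v; rewrite /a /=; [apply: sth | apply: rth | apply: rth].
have E b : teval (fun v => D (y v) (y v) (b v)) t = teval b t by apply: eq_teval => v.
by rewrite !E !Dyyx.
Qed.

(** * The abelian group on a block modulo a centralizing congruence *)

Section BlockGroup.
Variables (th ga : relA A) (u : C).
Hypotheses (cth : congruence th) (cga : congruence ga) (cen : centralizes th th ga).

Let rth x : th x x. Proof. by case: cth. Qed.
Let sth x y : th x y -> th y x. Proof. by case: cth => _ [h _]; apply: h. Qed.
Let tth x y z : th x y -> th y z -> th x z. Proof. by case: cth => _ [_ [h _]]; apply: h. Qed.
Let rga x : ga x x. Proof. by case: cga. Qed.
Let sga x y : ga x y -> ga y x. Proof. by case: cga => _ [h _]; apply: h. Qed.
Let tga x y z : ga x y -> ga y z -> ga x z. Proof. by case: cga => _ [_ [h _]]; apply: h. Qed.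

Hypothesis ga_sub : forall x y, ga x y -> th x y.

(** Canonical representatives, which turn [ga] into equality: the result of [pick] depends only on
    the class. *)
Let rep x := odflt x [pick z | `[< ga x z >]].

Let ga_rep x : ga x (rep x).
Proof.
rewrite /rep; case: pickP => [z /asboolP //|h] /=; exact: rga.
Qed.

Let repP x y : ga x y -> rep x = rep y.
Proof.
move=> h; rewrite /rep.
have e : (fun z => `[< ga x z >]) =1 (fun z => `[< ga y z >]).
  move=> z; apply/asboolP/asboolP => k; first exact: tga (sga h) k.
  exact: tga h k.
rewrite (eq_pick e); case: pickP => //= /(_ y) /asboolP; by case.
Qed.

Let repK x : rep (rep x) = rep x. Proof. by apply/esym/repP/ga_rep. Qed.

Let blockD x y z : th u x -> th u y -> th u z -> th u (D x y z).
Proof. by move=> h1 h2 h3; rewrite -(Dxyy u u); apply: congruence_apply3. Qed.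

Let repD x y z : rep (D (rep x) y (rep z)) = rep (D x y z).
Proof.
apply: repP; apply: (congruence_apply3 cga); [|exact: rga|]; apply: sga; exact: ga_rep.
Qed.

(** [malcev_commutes] for the term [d] itself: a 3 by 3 array over the block may be transposed.
    Commutativity, associativity and inverses follow by filling the array with [u] suitably. *)
Let commD x1 x2 x3 y1 y2 y3 z1 z2 z3 :
  th u x1 -> th u x2 -> th u x3 -> th u y1 -> th u y2 -> th u y3 ->
  th u z1 -> th u z2 -> th u z3 ->
  rep (D (D x1 x2 x3) (D y1 y2 y3) (D z1 z2 z3)) =
  rep (D (D x1 y1 z1) (D x2 y2 z2) (D x3 y3 z3)).
Proof.
move=> *; apply: repP.
pose row (a b c : C) (v : 'I_3) := nth a [:: a; b; c] v.
have := malcev_commutes d (x := row x1 x2 x3) (y := row y1 y2 y3) (z := row z1 z2 z3) cth cga cen.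
have E : (fun v => D (row x1 x2 x3 v) (row y1 y2 y3 v) (row z1 z2 z3 v)) =1
   row (D x1 y1 z1) (D x2 y2 z2) (D x3 y3 z3) by case=> [[|[|[|]]]].
rewrite (eq_teval _ E); apply.
all: case=> [[|[|[|m]]] lt_m] //=; (apply: (@tth _ u); [apply: sth|]; assumption).
Qed.

Let inblock x := `[< th u x >] && (rep x == x).
Let T := {x : C | inblock x}.

Let inblock_rep x : th u x -> inblock (rep x).
Proof.
move=> h; rewrite /inblock repK eqxx andbT; apply/asboolP.
exact: tth h (ga_sub (ga_rep x)).
Qed.

Let one : T := exist _ (rep u) (inblock_rep (rth u)).
Let mk x : T := insubd one (rep x).

Let val_mk x : th u x -> val (mk x) = rep x.
Proof. by move=> h; rewrite /mk insubdK //; apply: inblock_rep. Qed.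

Let block_val (a : T) : th u (val a).
Proof. by have /andP[/asboolP] := valP a. Qed.

Let mk_val (a : T) : mk (val a) = a.
Proof. by apply: val_inj; rewrite val_mk; have /andP[_ /eqP] := valP a. Qed.

Let eq_mk x y : th u x -> th u y -> rep x = rep y -> mk x = mk y.
Proof. by move=> hx hy h; apply: val_inj; rewrite !val_mk. Qed.

(** On the block [d x y z] behaves as x - y + z, and [u] is taken as zero. *)
Let mul (a b : T) := mk (D (val a) u (val b)).
Let inv (a : T) := mk (D u (val a) u).

Let mul_mk x y : th u x -> th u y -> mul (mk x) (mk y) = mk (D x u y).
Proof.
move=> hx hy; apply: val_inj; rewrite /mul [in LHS]val_mk ?val_mk ?repD //.
all: rewrite ?val_mk //; apply: blockD => //.
all: by rewrite ?val_mk //; apply: tth (ga_sub (ga_rep _)).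
Qed.

Let oneE : one = mk u. Proof. by apply: val_inj; rewrite val_mk. Qed.

Let mulC : commutative mul.
Proof.
move=> a b; rewrite -(mk_val a) -(mk_val b) !mul_mk //.
apply: eq_mk; try exact: blockD.
(* The array has rows (u, u, a), (u, u, u), (b, u, u). *)
by have := @commD u u (val a) u u u (val b) u u; rewrite !Dxyy !Dyyx; apply.
Qed.

Let mulA : associative mul.
Proof.
move=> a b c; rewrite -(mk_val a) -(mk_val b) -(mk_val c) !mul_mk //; try exact: blockD.
apply: eq_mk; try by do ?apply: blockD.
by have := @commD (val a) u (val b) u u u u u (val c); rewrite !Dxyy !Dyyx => ->.
Qed.

Let mul1 : left_id one mul.
Proof. by move=> a; rewrite -(mk_val a) oneE mul_mk // Dyyx. Qed.

Let mulV : left_inverse one inv mul.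
Proof.
move=> a; rewrite mulC /inv -{1}(mk_val a) oneE mul_mk //; last exact: blockD.
apply: eq_mk => //; first by do ?apply: blockD.
by have := @commD (val a) u u u u u u (val a) u; rewrite !Dxyy !Dyyx; apply.
Qed.

(** The function is a character of the block group composed with [mk]; [v] makes that group
    nontrivial. *)
Lemma block_character v : th u v -> ~ ga u v ->
  exists (p : nat) (f : {ffun C -> 'F_p}), [/\ prime p,
    forall x y z, th u x -> th u y -> th u z -> f (D x y z) = (f x - f y + f z)%R,
    forall x y, th u x -> ga x y -> f x = f y &
    exists2 x, th u x & f x <> f u].
Proof.
move=> huv nuv.
have ne : mk v <> one.
  rewrite oneE => /(congr1 val); rewrite !val_mk // => e; apply: nuv.
  by apply: tga (ga_rep u) _; rewrite -e; apply/sga/ga_rep.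
have [p [f [pp fM [a fa]]]] := character_of_laws mulA mul1 mulC mulV ne.
exists p, [ffun x => f (mk x)]; split=> //.
- move=> x y z hx hy hz; rewrite !ffunE; apply/eqP.
  rewrite addrAC -subr_eq opprK -!fM; apply/eqP; congr (f _).
  rewrite !mul_mk //; last exact: blockD.
  apply: eq_mk; try by do ?apply: blockD.
  (* Rows (x, y, z), (u, y, y), (u, u, y): in the group, d x y z + y = x + z. *)
  by have := @commD x y z u y y u u y; rewrite !Dxyy !Dyyx; apply.
- by move=> x y hx hxy; rewrite !ffunE /mk (repP hxy).
- exists (val a) => //; rewrite !ffunE mk_val => e; apply: fa.
  have := fM one one; rewrite mul1 -oneE in e *.
  by rewrite e => /eqP; rewrite -subr_eq0 opprD addNKr oppr_eq0 => /eqP.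
Qed.

End BlockGroup.
End Malcev.

(** * Refining congruences by good functions *)

Section Good.
Variables (A : finAlgebra) (p : nat).
Local Notation C := (carrier A).
Local Notation fn := {ffun C -> 'F_p}.
Local Open Scope ring_scope.

Definition set_arg (r : nat) (e : {ffun 'I_r -> C}) (j : 'I_r) (z : C) :
  {ffun 'I_r -> C} := [ffun k => if k == j then z else e k].

(** The contribution of argument [j] to [f] after the operation, normalised to vanish at the base
    point [e]. *)
Definition pull (f : fn) (i : 'I_(nops A)) (e : {ffun 'I_(arity i) -> C}) j : fn :=
  [ffun z => f (op (set_arg e j z)) - f (op e)].

(* [good th] is the largest splitting family: a coinductive predicate. *)
Definition splitting_family (th : relA A) (G : fn -> C -> Prop) : Prop :=
  forall f b (i : 'I_(nops A)) (e : {ffun 'I_(arity i) -> C}), G f b -> th (op e) b ->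
    (forall w : {ffun 'I_(arity i) -> C}, (forall j, th (w j) (e j)) ->
        f (op w) = f (op e) + \sum_j pull f e j (w j)) /\
    (forall j, G (pull f e j) (e j)).

Definition good (th : relA A) (f : fn) (b : C) : Prop :=
  exists2 G, splitting_family th G & G f b.

Lemma good_splitting (th : relA A) : splitting_family th (good th).
Proof.
move=> f b i e [G sG Gf] h; have [h1 h2] := sG f b i e Gf h.
by split=> // j; exists G.
Qed.

(** All pulls of a constant vanish. The constant 1 will let a refined map recover the old blocks. *)
Lemma good_const (th : relA A) b : good th [ffun=> 1] b.
Proof.
exists (fun f _ => exists c, f = [ffun=> c]); last by exists 1.
move=> f b' i e [c ->] _.
have E j : pull [ffun=> c] e j = [ffun=> 0].
  by apply/ffunP => z; rewrite !ffunE subrr.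
split=> [w _|j]; last by exists 0.
by rewrite !ffunE big1 ?addr0 // => j _; rewrite E ffunE.
Qed.

Section Affine.
Variable d : term A 'I_3.
Local Notation D := (apply3 d).
Hypotheses (Dxyy : forall x y, D x y y = x) (Dyyx : forall x y, D y y x = x).
Variables (th ga : relA A).
Hypotheses (cth : congruence th) (cga : congruence ga) (cen : centralizes th th ga)
  (ga_sub : forall x y, ga x y -> th x y).

(** Functions affine for [d] on a block and invariant under [ga] there form a splitting family,
    because modulo [ga] the operations commute with [d] on blocks of [th]. *)
Lemma good_affine (f : fn) b :
  (forall x y z, th b x -> th b y -> th b z -> f (D x y z) = f x - f y + f z) ->
  (forall x y, th b x -> ga x y -> f x = f y) ->
  good th f b.
Proof.
have [rth [sth [tth opth]]] := cth; have [rga [sga [tga opga]]] := cga.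
pose G (f : fn) b :=
  (forall x y z, th b x -> th b y -> th b z -> f (D x y z) = f x - f y + f z) /\
  (forall x y, th b x -> ga x y -> f x = f y).
move=> h1 h2; exists G; last by [].
move=> {h1 h2} {}f {}b i e [fD fga] he.
have inb (w : {ffun 'I_(arity i) -> C}) : (forall j, th (w j) (e j)) -> th b (op w).
  by move=> hw; apply: sth; apply: tth he; apply: opth.
have opD (x y z : {ffun 'I_(arity i) -> C}) : (forall j, th (x j) (e j)) ->
    (forall j, th (y j) (e j)) -> (forall j, th (z j) (e j)) ->
    f (op [ffun j => D (x j) (y j) (z j)]) = f (op x) - f (op y) + f (op z).
  move=> hx hy hz; rewrite -fD; try exact: inb.
  apply/esym/fga; first by rewrite -(Dxyy b b); apply: congruence_apply3 => //; apply: inb.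
  have := malcev_commutes Dxyy Dyyx (TApp (fun j => TVar A j)) (x := x) (y := y) (z := z) cth cga cen.
  rewrite /= => H; have {H} := H (fun j => tth _ _ _ (hx j) (sth _ _ (hy j)))
    (fun j => tth _ _ _ (hy j) (sth _ _ (hz j))).
  have E (w : {ffun 'I_(arity i) -> C}) : [ffun j => w j] = w.
    by apply/ffunP => j; rewrite ffunE.
  by rewrite !E.
have hset j z : th (e j) z -> forall k, th (set_arg e j z k) (e k).
  by move=> hz k; rewrite ffunE; case: eqP => [->|_]; [apply: sth | apply: rth].
split.
  move=> w hw.
  (* The arguments are moved from [e] to [w] one at a time. *)
  pose part (r : seq 'I_(arity i)) := [ffun j => if j \in r then w j else e j].
  suff H r : uniq r -> f (op (part r)) = f (op e) + \sum_(j <- r) pull f e j (w j).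
    have <- : part (enum 'I_(arity i)) = w.
      by apply/ffunP => j; rewrite ffunE mem_enum.
    rewrite H ?enum_uniq // big_enum /=; congr (_ + _); apply: eq_bigr => j _.
    by congr (pull f e j _); rewrite ffunE mem_enum.
  elim: r => [_|j r IH /= /andP[njr ur]].
    by rewrite big_nil addr0; congr (f (op _)); apply/ffunP => j; rewrite ffunE.
  (* At [j] the first two arguments of [d] agree, elsewhere the last two do. *)
  have -> : part (j :: r) = [ffun k => D (part r k) (e k) (set_arg e j (w j) k)].
    apply/ffunP => k; rewrite !ffunE inE; case: eqP => [->|_] /=.
      by rewrite (negbTE njr) Dyyx.
    by rewrite Dxyy.
  rewrite opD // ?IH //; last by apply: hset; apply: sth.
    by rewrite big_cons ffunE [_ + \sum_(_ <- _) _]addrC addrK [in RHS]addrA subrKC addrC.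
  by move=> k; rewrite ffunE; case: ifP.
move=> j; split=> [x y z hx hy hz|x y hx hxy]; rewrite !ffunE.
  have -> : set_arg e j (D x y z) =
      [ffun k => D (set_arg e j x k) (set_arg e j y k) (set_arg e j z k)].
    by apply/ffunP => k; rewrite !ffunE; case: eqP => // _; rewrite Dxyy.
  rewrite opD; try exact: hset.
  by rewrite addrA opprB addrA subrK.
congr (_ - _); apply: fga; first exact/inb/hset.
by apply: opga => k; rewrite !ffunE; case: eqP.
Qed.
End Affine.

Section Refine.
Variables (K : eqType) (kappa : C -> K).
Definition ker : relA A := fun x y => kappa x = kappa y.

(** All pairs of a function and a base point serve as coordinates, so the target is a finite type; a
    coordinate is 0 if the function is not good on that block or [a] lies outside it. *)
Definition refine (a : C) : {ffun fn * C -> 'F_p} :=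
  [ffun fb => if `[< good ker fb.1 fb.2 >] && (kappa a == kappa fb.2) then fb.1 a else 0].

(** The coordinate of the constant 1 at base point [x] is the indicator of the block of [x]. *)
Lemma refine_sub x y : refine x = refine y -> kappa x = kappa y.
Proof.
move/ffunP/(_ ([ffun=> 1], x)); rewrite !ffunE /= eqxx andbT.
rewrite asboolT; last exact: good_const.
by rewrite /=; case: eqP => // _ /eqP; rewrite oner_eq0.
Qed.

Lemma refine_good x y f b : refine x = refine y -> good ker f b -> kappa x = kappa b ->
  f x = f y.
Proof.
move=> e g h; have k := refine_sub e.
by move/ffunP/(_ (f, b)): e; rewrite !ffunE /= -k h eqxx asboolT.
Qed.

End Refine.

(** Split at base point [x]: the pulls are good, hence take the same value at [y j] as at [x j],
    where they vanish. *)
Lemma refine_congruence (K : eqType) (kappa : C -> K) : congruence (ker kappa) ->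
  congruence (ker (refine kappa)).
Proof.
move=> [_ [_ [_ opk]]].
split; first by [].
split; first by move=> x y; rewrite /ker => ->.
split; first by move=> x y z; rewrite /ker => -> ->.
move=> i x y h; apply/ffunP => -[f b]; rewrite !ffunE /=.
have hxy : kappa (op x) = kappa (op y) by apply: opk => j; apply: refine_sub (h j).
rewrite -hxy; case: asboolP => //= g; case: eqP => //= hb.
have [sp gp] := good_splitting g hb.
rewrite (sp y) => [|j]; last by apply/esym/(refine_sub (h j)).
rewrite big1 ?addr0 // => j _.
rewrite -(refine_good (h j) (gp j)) // ffunE.
have -> : set_arg x j (x j) = x by apply/ffunP => k; rewrite ffunE; case: eqP => [->|].
exact: subrr.
Qed.

End Good.

(** Otherwise induction along the derived series puts [th] below its last member, which is contained
    in equality. *)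
Lemma solvable_step (A : finAlgebra) (th : relA A) (u v : carrier A) :
  solvable_algebra A -> th u v -> u <> v ->
  exists s s' x y, [/\ is_commutator s s s', forall x y, th x y -> s x y, th x y & ~ s' x y].
Proof.
move=> [k [s [s0 [sc sk]]]] huv ne.
have [j lt_jk [hj nj]] : exists2 j, (j < k)%N & (forall x y, th x y -> s j x y) /\
    ~ (forall x y, th x y -> s j.+1 x y).
  apply: contrapT => H.
  have hs j : (j <= k)%N -> forall x y, th x y -> s j x y.
    elim: j => [//|j IH] lt_j; apply: contrapT => nj; apply: H; exists j => //.
    by split=> //; apply/IH/ltnW.
  exact/ne/sk/(hs k (leqnn k)).
exists (s j), (s j.+1).
have /existsNP[x /existsNP[y /not_implyP[hx nx]]] := nj.
by exists x, y; split=> //; apply: sc.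
Qed.

(** Meeting [ga] with [th] puts it below [th], as [block_character] asks; the [th] half of the
    condition holds by compatibility with terms. *)
Lemma centralizes_sub (A : finAlgebra) (al th ga : relA A) :
  congruence th -> (forall x y, th x y -> al x y) -> centralizes al al ga ->
  centralizes th th (fun x y => ga x y /\ th x y).
Proof.
move=> cth sub cen m l t a a' b b' ha hb ev [h1 h2]; split.
  by apply: cen h1 => *; apply: sub.
apply: congruence_teval => // -[i|j] //; by have [rth _] := cth.
Qed.

Lemma congruence_inter (A : finAlgebra) (th ga : relA A) :
  congruence ga -> congruence th -> congruence (fun x y => ga x y /\ th x y).
Proof.
move=> [r1 [s1 [t1 o1]]] [r2 [s2 [t2 o2]]]; split; first by [].
split; first by move=> x y [? ?]; split; auto.
split; first by move=> x y z [? ?] [? ?]; split; eauto.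
by move=> i f g h; split; [apply: o1|apply: o2] => j; case: (h j).
Qed.

(** A block character is affine, hence good, and its coordinate separates two elements of one
    block. *)
Lemma refine_strict (A : finAlgebra) (K : eqType) (kappa : carrier A -> K) u v :
  solvable_algebra A -> has_malcev_term A -> congruence (ker kappa) ->
  kappa u = kappa v -> u <> v ->
  exists p x y, [/\ prime p, kappa x = kappa y & refine p kappa x <> refine p kappa y].
Proof.
move=> sol [d hd] cth huv ne.
have Dxyy x y : apply3 d x y y = x by have [h _] := hd x y.
have Dyyx x y : apply3 d y y x = x.
  have [_ {2}<-] := hd x y; by apply: eq_teval; case=> [[|[|[|]]]].
have [s [s' [x [y [[cs' [cen _]] sub hxy nxy]]]]] := solvable_step sol (th := ker kappa) huv ne.
pose ga : relA A := fun x y => s' x y /\ ker kappa x y.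
have cga : congruence ga by apply: congruence_inter.
have cen' : centralizes (ker kappa) (ker kappa) ga by apply: centralizes_sub cen.
have ga_sub a b : ga a b -> ker kappa a b by case.
have nga : ~ ga x y by case.
have [p [f [pp fD fga [z hz fz]]]] := block_character Dxyy Dyyx cth cga cen' ga_sub hxy nga.
exists p, x, z; split=> // e; apply: fz; apply/esym.
apply: (refine_good e (b := x)) => //.
exact: (good_affine Dxyy Dyyx cth cga cen' fD fga).
Qed.

(** * One layer of gates *)

Lemma prod_bool_nat (R : comPzSemiRingType) (I : finType) (b : I -> bool) :
  (\prod_i (b i)%:R = ([forall i, b i] : nat)%:R :> R)%R.
Proof.
case: forallP => [h|/forallP]; first by rewrite big1 // => i _; rewrite h.
rewrite negb_forall => /existsP[i /negbTE bi].
by apply/eqP; rewrite (bigD1 i) //= bi mul0r.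
Qed.

Section Level.
Variables (A : finAlgebra) (p : nat) (E T : finType).
Local Notation C := (carrier A).
Local Notation key := ({ffun C -> 'F_p} * C)%type.
Variable kappa : C -> {ffun E -> T}.
Local Open Scope ring_scope.

Let canon (a : C) := odflt a [pick z | kappa z == kappa a].

Let kappa_canon a : kappa (canon a) = kappa a.
Proof. by rewrite /canon; case: pickP => [z /eqP|]. Qed.

Let eq_canon a b : kappa a = kappa b -> canon a = canon b.
Proof.
rewrite /canon => e; rewrite (eq_pick (Q := fun z => kappa z == kappa b)); last by move=> z; rewrite e.
by case: pickP => // /(_ b); rewrite eqxx.
Qed.

Section Access.
Variables (n N : nat) (accX : 'I_n -> 'I_N) (accN : nat -> E * T -> 'I_N)
  (iota : bool -> C).

(** A product of one-hot bits, hence the indicator that node [v] lies in the class of [a]. *)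
Definition class_mon (v : nat) (a : C) : seq 'I_N :=
  [seq accN v (e, kappa a e) | e <- enum E].

Definition encodes (y : 'I_N -> bool) (v : nat) (w : C) : Prop :=
  forall et, y (accN v et) = (kappa w et.1 == et.2).

Lemma class_mon_val (y : 'I_N -> bool) v w a : encodes y v w ->
  \prod_(k <- class_mon v a) (y k)%:R = (kappa w == kappa a)%:R :> 'F_p.
Proof.
move=> h; rewrite big_map big_enum /= (eq_bigr (fun e => (kappa w e == kappa a e)%:R)).
  rewrite prod_bool_nat; congr (nat_of_bool _)%:R.
  apply/forallP/eqP => [e|-> //]; by apply/ffunP => i; apply/eqP.
by move=> e _; rewrite h.
Qed.

(* Exactly one [e] has a nonzero monomial: the canonical representatives of the classes
   of the arguments. *)
Definition op_terms (i : 'I_(nops A)) (args : 'I_(arity i) -> nat)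
    (ix : nat -> key -> nat) (k : key) : seq (prod_term p N) :=
  flatten [seq
    (let m := flatten [seq class_mon (args j) (e j) | j <- enum 'I_(arity i)] in
     (k.1 (op e), m, 0%N) ::
       [seq (1, m, ix (args j) (pull k.1 e j, e j)) | j <- enum 'I_(arity i)])
    | e : {ffun 'I_(arity i) -> C} <- enum {ffun 'I_(arity i) -> C} &
      [forall j, canon (e j) == e j] &&
      (`[< good (ker kappa) k.1 k.2 >] && (kappa (op e) == kappa k.2))].

Lemma op_terms_val i args ix k P (y : 'I_N -> bool) (w : {ffun 'I_(arity i) -> C}) :
  congruence (ker kappa) ->
  (forall j, encodes y (args j) (w j)) ->
  (forall j k, vertex_val y P (ix (args j) k) = refine p kappa (w j) k) ->
  \sum_(t <- op_terms args ix k) term_val y P t = refine p kappa (op w) k.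
Proof.
move=> [_ [_ [_ opk]]] hy hix; case: k => f b.
rewrite big_flatten big_map big_filter big_enum_cond /=.
pose e0 : {ffun 'I_(arity i) -> C} := [ffun j => canon (w j)].
have ke0 j : kappa (e0 j) = kappa (w j) by rewrite ffunE kappa_canon.
have kope0 : kappa (op e0) = kappa (op w) by apply: opk.
have y0 : vertex_val y P 0 = 1.
  by rewrite -[P]cat0s vertex_val_cat.
rewrite (eq_bigr (fun e : {ffun 'I_(arity i) -> C} =>
  [forall j, kappa (w j) == kappa (e j)]%:R *
    (f (op e) + \sum_j refine p kappa (w j) (pull f e j, e j)))); last first.
  move=> e _; rewrite big_cons big_map big_enum /= /term_val /= y0 mulr1.
  have -> : \prod_(k <- flatten [seq class_mon (args j) (e j) | j <- enum 'I_(arity i)])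
      (y k)%:R = [forall j, kappa (w j) == kappa (e j)]%:R :> 'F_p.
    rewrite big_flatten big_map big_enum /= -prod_bool_nat.
    by apply: eq_bigr => j _; apply: class_mon_val.
  rewrite mulrDr mulr_sumr mulrC; congr (_ + _); apply: eq_bigr => j _.
  by rewrite mul1r hix.
rewrite ffunE /=; case: asboolP => [g|_] /=; last first.
  by apply: big_pred0 => e; rewrite andbF.
(* If [op w] misses the block of [b], each listed tuple differs in class from [w], so every
   indicator is 0. *)
case: eqP => [hb|nb]; last first.
  apply: big1 => e /andP[_ /eqP he].
  case: forallP => [h|_]; last by rewrite mul0r.
  by case: nb; rewrite -he; apply: opk => j; apply/eqP.
rewrite (bigD1 e0) /=; last first.
  rewrite kope0 hb eqxx andbT; apply/forallP => j; apply/eqP.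
  by apply: eq_trans (eq_canon (ke0 j)) _; rewrite ffunE.
rewrite [X in _ + X]big1 ?addr0; last first.
  move=> e /andP[/andP[/forallP ce _] /eqP ne].
  case: forallP => [h|_]; last by rewrite mul0r.
  case: ne; apply/ffunP => j; rewrite ffunE -(eqP (ce j)).
  by apply: eq_canon; apply/esym/eqP.
have -> : [forall j, kappa (w j) == kappa (e0 j)] by apply/forallP => j; rewrite ke0.
have [|sp gp] := good_splitting (e := e0) g; first by rewrite /ker kope0.
rewrite mul1r (sp w) => [|j]; last by rewrite /ker ke0.
congr (_ + _); apply: eq_bigr => j _.
by rewrite ffunE /= asboolT // ke0 eqxx.
Qed.

Lemma op_terms_size i args ix k :
  (size (@op_terms i args ix k) <= #|{ffun 'I_(arity i) -> C}| * (arity i).+1)%N.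
Proof.
rewrite size_flatten /shape -map_comp sumnE big_map big_filter.
rewrite (eq_bigr (fun _ => (arity i).+1)); last first.
  by move=> e _ /=; rewrite size_map size_enum_ord.
rewrite big_enum_cond /= big_mkcond /= -sum_nat_const leq_sum // => e _; by case: ifP.
Qed.

Lemma op_terms_all i args ix k s : (forall j k, ix (args j) k <= s)%N ->
  all (fun t => (size t.1.2 <= arity i * #|E|) && (t.2 <= s))%N (@op_terms i args ix k).
Proof.
move=> hs; apply/allP => t /flatten_mapP[e _].
have sm : size (flatten [seq class_mon (args j) (e j) | j <- enum 'I_(arity i)]) =
    (arity i * #|E|)%N.
  rewrite size_flatten /shape -map_comp sumnE big_map big_enum /=.
  rewrite (eq_bigr (fun _ => #|E|)) ?sum_nat_const ?card_ord // => j _ /=.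
  by rewrite size_map cardE.
by rewrite inE => /orP[/eqP->|/mapP[j _ ->]] /=; rewrite sm leqnn ?hs.
Qed.

(** The extra 1 here and the 2 in [terms_bound] cover input nodes: two terms, with monomials of
    length at most 1. These bounds do not depend on the circuit. *)
Definition mon_bound : nat := ((\sum_(i < nops A) arity i) * #|E| + 1)%N.
Definition terms_bound : nat :=
  (\sum_(i < nops A) #|{ffun 'I_(arity i) -> C}| * (arity i).+1 + 2)%N.
Definition node_bound : nat := (#|{: key}| * ((mon_bound + 2) * terms_bound + 1))%N.

(** An input node is interpolated affinely between the two values of [iota]. *)
Definition gate_terms (m : nat) (g : cgate A n m) (ix : nat -> key -> nat) (k : key) :
  seq (prod_term p N) :=
  match g with
  | CVar j => [:: (refine p kappa (iota true) k - refine p kappa (iota false) k, [:: accX j], 0%N);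
                  (refine p kappa (iota false) k, [::], 0%N)]
  | CConst a => [:: (refine p kappa a k, [::], 0%N)]
  | COp i args => op_terms (fun j => args j : nat) ix k
  end.

Lemma gate_terms_all m (g : cgate A n m) ix k s : (forall v k, v < m -> ix v k <= s)%N ->
  all (fun t => (size t.1.2 <= mon_bound) && (t.2 <= s))%N (gate_terms g ix k).
Proof.
move=> hs; case: g => [j|a|i args] //=; first by rewrite /mon_bound addn1.
apply: sub_all (op_terms_all (s := s) _ _); last by move=> j k'; apply: hs.
move=> t /andP[h ->]; rewrite andbT (leq_trans h) // /mon_bound.
rewrite (leq_trans _ (leq_addr _ _)) // leq_mul2r (bigD1 i) //= leq_addr orbT.
by [].
Qed.

Lemma gate_terms_size m (g : cgate A n m) ix k : (size (gate_terms g ix k) <= terms_bound)%N.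
Proof.
case: g => [j|a|i args] /=; rewrite /terms_bound; try by rewrite addn2.
apply: leq_trans (op_terms_size _ _ _) _.
by rewrite (bigD1 i) //= -addnA leq_addr.
Qed.

Definition node_val m (c : circ A n m) (x : 'I_n -> bool) (v : nat) : C :=
  nth (iota false) (cvals c (iota \o x)) v.

Definition consistent m (c : circ A n m) (x : 'I_n -> bool) (y : 'I_N -> bool) : Prop :=
  (forall j, y (accX j) = x j) /\ (forall v, (v < m)%N -> encodes y v (node_val c x v)).

Lemma node_val_snoc m (c : circ A n m) g x v :
  node_val (csnoc c g) x v =
  if (v < m)%N then node_val c x v else
  if v == m then geval (iota \o x) (cvals c (iota \o x)) g else iota false.
Proof. by rewrite /node_val /= nth_rcons size_tuple. Qed.

Lemma gate_terms_val m (c : circ A n m) g ix k P x y :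
  congruence (ker kappa) -> consistent c x y ->
  (forall v k, (v < m)%N -> vertex_val y P (ix v k) = refine p kappa (node_val c x v) k) ->
  \sum_(t <- gate_terms g ix k) term_val y P t =
    refine p kappa (geval (iota \o x) (cvals c (iota \o x)) g) k.
Proof.
move=> ck [hx hy] hix.
have y0 : vertex_val y P 0 = 1 by rewrite -[P]cat0s vertex_val_cat.
case: g => [j|a|i args] /=.
- rewrite big_cons big_seq1 /term_val /= big_seq1 big_nil y0 !mulr1 hx.
  by case: (x j); rewrite ?mulr1 ?subrK // mulr0 add0r.
- by rewrite big_seq1 /term_val /= big_nil y0 !mulr1.
have wE j : [ffun j => tnth (cvals c (iota \o x)) (args j)] j = node_val c x (args j).
  by rewrite ffunE (tnth_nth (iota false)).
by apply: op_terms_val => // j; [|move=> k']; rewrite wE; [apply: hy | apply: hix].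
Qed.

(** Every coordinate of [refine] is carried along at every node, since a good function of a node
    calls for its pulls at the predecessors. *)
Lemma circ_program m (c : circ A n m) : congruence (ker kappa) ->
  exists (P : program p N) (ix : nat -> key -> nat),
    (size P <= m * node_bound)%N /\
    forall v k, (v < m)%N -> (ix v k <= size P)%N /\
      forall x y, consistent c x y -> vertex_val y P (ix v k) = refine p kappa (node_val c x v) k.
Proof.
move=> ck; elim: c => {m} [|m c [P [ix [sP hP]]] g]; first by exists [::], (fun _ _ => 0%N).
have [|k|Q [ixQ [sQ hQ]]] := @extend_family p N P mon_bound terms_bound _ (gate_terms g ix).
- by move=> k; apply: gate_terms_all => v k' /(hP v k')[].
- exact: gate_terms_size.
exists (P ++ Q), (fun v k => if (v < m)%N then ix v k else ixQ k); split.
  by rewrite size_cat mulSn addnC leq_add.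
move=> v k; rewrite ltnS leq_eqVlt => hv.
case: (ltnP v m) hv => [lt_v _|le_v].
  have [h1 h2] := hP v k lt_v; split; first by rewrite size_cat (leq_trans h1) // leq_addr.
  move=> x y [hx hy]; rewrite vertex_val_cat // node_val_snoc lt_v; apply: h2.
  by split=> // u lt_u; have := hy u (ltnW lt_u); rewrite node_val_snoc lt_u.
rewrite orbF => /eqP ev; have [h1 h2] := hQ k; split=> // x y [hx hy].
rewrite h2 node_val_snoc ev ltnn eqxx.
have cc : consistent c x y.
  by split=> // u lt_u; have := hy u (ltnW lt_u); rewrite node_val_snoc lt_u.
by apply: gate_terms_val => // u k' lt_u; apply: (hP u k' lt_u).2.
Qed.

Definition level_bound (m : nat) : nat :=
  (N + 3 * (m * node_bound + (mon_bound + #|E| + 2) * (terms_bound + #|C|) + 1) + 1)%N.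

(** Input bits are passed upwards, because a layer reads only the one below. *)
Lemma copy_gate j : exists g : bgate p, [/\ forall e, (bwire (b := g) e < N)%N,
  forall m, (gate_size g <= level_bound m)%N &
  forall m (c : circ A n m) x (y : nat -> bool), consistent c x (fun e => y e) ->
    bgate_out g y = x j].
Proof.
have [|g [h1 h2 h3]] := @gate_of_sum p N [::] 1 [:: (1, [:: accX j], 0%N)] [set 1]; first by [].
exists g; split=> // [m|m c x y [hx _]].
  apply: leq_trans h2 _; rewrite /level_bound /terms_bound /mon_bound /=; lia.
rewrite h3 big_seq1 /term_val /= big_seq1 hx /vertex_val /= mul1r mulr1 inE.
by case: (x j); rewrite ?eqxx // eq_sym oner_eq0.
Qed.

Lemma node_gate m (c : circ A n m) v (k : key) (t : 'F_p) : congruence (ker kappa) ->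
  (v < m)%N ->
  exists g : bgate p, [/\ forall e, (bwire (b := g) e < N)%N,
  (gate_size g <= level_bound m)%N &
  forall x (y : nat -> bool), consistent c x (fun e => y e) ->
    bgate_out g y = (refine p kappa (node_val c x v) k == t)].
Proof.
move=> ck lt_v; have [P [ix [sP hP]]] := circ_program c ck.
have [h1 h2] := hP v k lt_v.
have [|g [k1 k2 k3]] := @gate_of_sum p N P 0 [:: (1, [::], ix v k)] [set t].
  by rewrite /= h1.
exists g; split=> // [|x y cy].
  apply: leq_trans k2 _; rewrite /level_bound /terms_bound /mon_bound /=; nia.
by rewrite k3 big_seq1 /term_val /= big_nil (h2 _ _ cy) !mul1r inE.
Qed.

(** For injective [kappa] the class monomials are indicators of single elements, so their sum over
    [S] is 0 or 1. *)
Lemma output_gate m (c : circ A n m) v (S : {set C}) : injective kappa -> (v < m)%N ->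
  exists g : bgate p, [/\ forall e, (bwire (b := g) e < N)%N,
  (gate_size g <= level_bound m)%N &
  forall x (y : nat -> bool), consistent c x (fun e => y e) ->
    bgate_out g y = (node_val c x v \in S)].
Proof.
move=> ik lt_v.
pose L : seq (prod_term p N) := [seq (1, class_mon v a, 0%N) | a <- enum S].
have [|g [k1 k2 k3]] := @gate_of_sum p N [::] #|E| L [set 1].
  by apply/allP => t /mapP[a _ ->] /=; rewrite size_map cardE !leqnn.
exists g; split=> // [|x y cy].
  apply: leq_trans k2 _.
  have : (size L <= #|C|)%N by rewrite size_map -cardE max_card.
  rewrite /level_bound /terms_bound /mon_bound /=; nia.
rewrite k3 big_map big_enum /=.
rewrite (eq_bigr (fun a => (a == node_val c x v)%:R)); last first.
  move=> a _; rewrite /term_val /= (class_mon_val _ (cy.2 v lt_v)) /vertex_val /= mul1r mulr1.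
  by rewrite (inj_eq ik) eq_sym.
rewrite inE; case: (boolP (node_val c x v \in S)) => hS.
  by rewrite (bigD1 (node_val c x v)) //= eqxx big1 ?addr0 ?eqxx // => a /andP[_ /negbTE->].
rewrite big1 => [|a aS]; first by rewrite eq_sym oner_eq0.
by case: eqP aS hS => // -> ->.
Qed.

End Access.
End Level.

(** * Layered circuits *)

(** A filler: [lgate] is total, so positions beyond the width of a layer need a gate too. *)
Lemma constant_gate (p N : nat) : exists g : bgate p,
  (forall e, bwire (b := g) e < N) /\ forall y, bgate_out g y = false.
Proof.
have [//|g [h _ h']] := @gate_of_sum p N [::] 0 [::] set0.
by exists g; split=> // y; rewrite h' inE.
Qed.

(** [V l x j] is the intended output of gate [j] in layer [l]; each gate need only be correct when
    the wires it reads are. *)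
Lemma lcircuit_exists (ps : seq nat) (n : nat) (wd bd : nat -> nat)
    (V : nat -> (nat -> bool) -> nat -> bool) :
  let wires l := if l is l'.+1 then wd l' else n in
  let input l x := if l is l'.+1 then V l' x else x in
  0 < size ps -> wd (size ps).-1 = 1 ->
  (forall l j, l < size ps -> j < wd l -> exists g : bgate (nth 0 (rev ps) l),
    [/\ forall e, bwire (b := g) e < wires l, gate_size g <= bd l &
        forall x y, (forall i, i < wires l -> y i = input l x i) ->
          bgate_out g y = V l x j]) ->
  exists C : lcircuit ps n, lsize C <= \sum_(l < size ps) wd l * bd l /\
    forall x, lval C x (size ps).-1 0 = V (size ps).-1 x 0.
Proof.
move=> wires input ps0 top hg.
have ex l j : exists g : bgate (nth 0 (rev ps) l), l < size ps -> j < wd l ->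
    [/\ forall e, bwire (b := g) e < wires l, gate_size g <= bd l &
        forall x y, (forall i, i < wires l -> y i = input l x i) ->
          bgate_out g y = V l x j].
  case: (boolP ((l < size ps) && (j < wd l))) => [/andP[h1 h2]|h].
    by have [g gP] := hg l j h1 h2; exists g.
  have [g _] := constant_gate (nth 0 (rev ps) l) 0; exists g => h1 h2.
  by rewrite h1 h2 in h.
pose G l j := projT1 (cid (ex l j)).
have GP l j : l < size ps -> j < wd l -> _ := projT2 (cid (ex l j)).
have wf l j : l < size ps -> j < wd l ->
    forall e, bwire (b := G l j) e < (if l is l'.+1 then wd l' else n).
  by move=> h1 h2; have [] := GP l j h1 h2.
pose C := @LCircuit ps n wd G top wf; exists C; split.
  rewrite /lsize; apply: leq_sum => l _ /=.
  rewrite -[X in _ <= X * _]card_ord -sum_nat_const; apply: leq_sum => j _.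
  by have [_] := GP l j (ltn_ord l) (ltn_ord j).
suff H l x j : l < size ps -> j < wd l -> lval C x l j = V l x j.
  by move=> x; apply: H; rewrite ?top // prednK.
elim: l j => [|l IH] j h1 h2 /=; have [_ _ h3] := GP _ j h1 h2; apply: h3 => // i hi /=.
by apply: IH => //; apply: ltnW.
Qed.

(** * The tower of refinements and the wires between layers *)

Section Levels.
Variable A : finAlgebra.
Local Notation C := (carrier A).

(** The index and value types change with each refinement, so they are bundled with the map. *)
Record level := Level {
  level_index : finType;
  level_value : finType;
  level_map : C -> {ffun level_index -> level_value} }.

Definition next_level (L : level) (p : nat) : level := Level (refine p (@level_map L)).

Definition level0 : level := @Level void unit (fun _ => [ffun=> tt]).

Definition levels (qs : seq nat) : level := foldl next_level level0 qs.

Lemma levels_rcons qs p : levels (rcons qs p) = next_level (levels qs) p.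
Proof. by rewrite /levels -cats1 foldl_cat. Qed.

Lemma level0_congruence : congruence (ker (@level_map level0)).
Proof. by split; [|split; [|split]]. Qed.

Lemma levels_congruence qs : congruence (ker (@level_map (levels qs))).
Proof.
elim/last_ind: qs => [|qs p IH]; first exact: level0_congruence.
rewrite levels_rcons; exact: refine_congruence.
Qed.

(** Each strict refinement lowers the number of identified pairs. *)
Lemma injective_levels : solvable_algebra A -> has_malcev_term A ->
  exists qs, all prime qs /\ injective (@level_map (levels qs)).
Proof.
move=> sol mal; rewrite /levels; move: level0_congruence.
pose pairs (L : level) := [set q : C * C | level_map L q.1 == level_map L q.2].
move: {2}#|pairs level0| (leqnn #|pairs level0|) => N.
elim: N level0 => [|N IH] L hN cL;
  case: (pselect (injective (@level_map L))) => [iL|nL]; try by exists [::].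
all: have [u [v [huv ne]]] : exists u v, level_map L u = level_map L v /\ u <> v by
  apply: contrapT => h; apply: nL => u v e; apply: contrapT => ne; apply: h; exists u, v.
  have : (u, v) \in pairs L by rewrite inE /= huv.
  by move: hN; rewrite leqn0 cards_eq0 => /eqP ->; rewrite inE.
have [p [x [y [pp hxy nxy]]]] := refine_strict sol mal cL huv ne.
have [||qs [hq iq]] := IH (next_level L p); last by exists (p :: qs); rewrite /= pp hq.
  rewrite -ltnS; apply: leq_trans hN; apply: proper_card; apply/properP; split.
    by apply/subsetP => -[a b]; rewrite !inE /= => /eqP/refine_sub ->.
  by exists (x, y); rewrite !inE /= ?hxy //; apply/eqP.
exact: refine_congruence.
Qed.

Section Simulation.
Variables (n m : nat) (c : circ A n m.+1) (iota : bool -> C) (S : {set C}).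

Definition wire (L : level) : finType :=
  ('I_n + 'I_m.+1 * (level_index L * level_value L))%type.

Definition wire_val (L : level) (x : nat -> bool) (w : wire L) : bool :=
  match w with
  | inl j => x j
  | inr (v, (e, t)) => level_map L (node_val iota c (fun j => x j) v) e == t
  end.

Definition wire_bit (L : level) (x : nat -> bool) (i : nat) : bool :=
  if @insub _ _ 'I_#|wire L| i is Some o then wire_val x (enum_val o) else false.

Lemma wire_bitE (L : level) x (w : wire L) : wire_bit L x (enum_rank w) = wire_val x w.
Proof.
rewrite /wire_bit; case: insubP => [o _ /val_inj ->|]; first by rewrite enum_rankK.
by rewrite ltn_ord.
Qed.

(** What a layer may assume of its input: it contains the input bits and encodes the [L]-class of
    every node. *)
Definition accessible (L : level) (N : nat) (input : (nat -> bool) -> nat -> bool) : Prop :=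
  exists (accX : 'I_n -> 'I_N) (accN : nat -> level_index L * level_value L -> 'I_N),
    forall x y : nat -> bool, (forall i, i < N -> y i = input x i) ->
      consistent (@level_map L) accX accN iota c (fun j => x j) (fun e => y e).

Lemma accessible0 : accessible level0 n id.
Proof.
exists id, (fun _ et => match (et.1 : void) with end) => x y h; split=> [j|v _ [[]]].
by rewrite h.
Qed.

Lemma accessible_wire (L : level) : accessible L #|wire L| (wire_bit L).
Proof.
exists (fun j => enum_rank (inl j : wire L)), (fun v et => enum_rank (inr (inord v, et) : wire L)).
move=> x y h; split=> [j|v lt_v [e t]]; first by rewrite h ?ltn_ord // wire_bitE.
by rewrite h ?ltn_ord // wire_bitE /= inordK.
Qed.

Lemma wire_gate (L : level) p N input (w : wire (next_level L p)) :
  congruence (ker (@level_map L)) -> accessible L N input ->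
  exists g : bgate p, [/\ forall e, bwire (b := g) e < N,
    gate_size g <= level_bound A p (level_index L) N m.+1 &
    forall x y, (forall i, i < N -> y i = input x i) -> bgate_out g y = wire_val x w].
Proof.
move=> cL [accX [accN acc]]; case: w => [j|[v [k t]]].
  have [g [h1 h2 h3]] := copy_gate p (@level_map L) accX accN iota j.
  by exists g; split=> // x y /acc /h3.
have [g [h1 h2 h3]] := node_gate accX accN iota c k t cL (ltn_ord v).
by exists g; split=> // x y /acc /h3.
Qed.

Lemma wires_output_gate (L : level) p N input :
  injective (@level_map L) -> accessible L N input ->
  exists g : bgate p, [/\ forall e, bwire (b := g) e < N,
    gate_size g <= level_bound A p (level_index L) N m.+1 &
    forall x y, (forall i, i < N -> y i = input x i) ->
      bgate_out g y = (node_val iota c (fun j => x j) m \in S)].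
Proof.
move=> iL [accX [accN acc]].
have [g [h1 h2 h3]] := output_gate p accX accN iota c S iL (ltnSn m).
by exists g; split=> // x y /acc /h3.
Qed.

End Simulation.
End Levels.

(** * Assembly of the layers and the polynomial size bound *)

Section Assembly.
Variables (A : finAlgebra) (qs : seq nat).
Local Notation C := (carrier A).
Hypothesis inj_levels : injective (@level_map A (levels A qs)).

Let lev l : level A := levels A (take l qs).
(** Layers count from the bottom, where [qs] starts. The final 2 belongs to the output gate and is
    an arbitrary choice. *)
Let prime_at l := nth 0 (rcons qs 2) l.
Let width_bound l := 1 + #|level_index (lev l)| * #|level_value (lev l)|.
(** [level_bound] is affine in the number of wires and of nodes; its value at 0 and 1 collects the
    constants. *)
Let size_bound l := level_bound A (prime_at l) (level_index (lev l)) 0 1 + width_bound l.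
Let total_bound := \sum_(l < (size qs).+1) width_bound l.+1 * size_bound l.

(** Width and gate size of a layer are both linear in [n + m.+1], whence the square. Below the top,
    layer [l] outputs the encoding for [lev l.+1]. *)
Lemma nuDet_simulation (n m : nat) (c : circ A n m.+1) (iota : bool -> C) (S : {set C}) :
  exists D : lcircuit (2 :: rev qs) n,
    lsize D <= total_bound * (n + m.+1) ^ 2 /\
    forall x, lval D x (size qs) 0 = (node_val iota c (fun j => x j) m \in S).
Proof.
pose wd l := if l < size qs then #|wire n m (lev l.+1)| else 1.
pose V l x j := if l < size qs then wire_bit c iota (lev l.+1) x j
  else node_val iota c (fun j => x j) m \in S.
pose wires l := if l is l'.+1 then wd l' else n.
pose input l x := if l is l'.+1 then V l' x else x.
pose bd l := level_bound A (prime_at l) (level_index (lev l)) (wires l) m.+1.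
have rev_ps : rev (2 :: rev qs) = rcons qs 2 by rewrite rev_cons revK.
have sz : size (2 :: rev qs) = (size qs).+1 by rewrite /= size_rev.
have acc l : l <= size qs -> accessible c iota (lev l) (wires l) (input l).
  case: l => [_|l lt_l]; first by rewrite /lev take0; apply: accessible0.
  by rewrite /wires /wd lt_l /input /V lt_l; apply: accessible_wire.
have levS l : l < size qs -> lev l.+1 = next_level (lev l) (prime_at l).
  move=> lt_l; rewrite /lev (take_nth 0 lt_l) levels_rcons /prime_at nth_rcons.
  by rewrite lt_l.
have [| |l j|D [sD vD]] := @lcircuit_exists (2 :: rev qs) n wd bd V.
- by [].
- by rewrite sz /wd ltnn.
- rewrite sz rev_ps -/(prime_at l) ltnS => le_l; rewrite /wd /V.
  case: ifP => lt_l hj.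
    have gates (w : wire n m (lev l.+1)) : exists g : bgate (prime_at l),
        [/\ forall e, bwire (b := g) e < wires l, gate_size g <= bd l &
        forall x y, (forall i, i < wires l -> y i = input l x i) ->
          bgate_out g y = wire_val c iota x w].
      move: w; rewrite levS // => w.
      exact: wire_gate w (levels_congruence A _) (acc l le_l).
    have [g [h1 h2 h3]] := gates (enum_val (Ordinal hj)).
    exists g; split=> // x y /h3 ->.
    rewrite -(wire_bitE c iota x (enum_val (Ordinal hj))) enum_valK.
    by [].
  have el : l = size qs by apply/eqP; rewrite eqn_leq le_l leqNgt lt_l.
  have iL : injective (@level_map A (lev l)) by rewrite /lev el take_size.
  by have [g gP] := wires_output_gate S (prime_at l) iL (acc l le_l); exists g.
exists D; split; last by move=> x; rewrite sz /= in vD; rewrite vD /V ltnn.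
apply: leq_trans sD _; rewrite sz /total_bound big_distrl /=; apply: leq_sum => l _.
set M := n + m.+1.
have wW l' : #|wire n m (lev l')| <= width_bound l' * M.
  rewrite /wire card_sum card_prod !card_ord card_prod /width_bound /M; nia.
have w1 l' : wd l' <= width_bound l'.+1 * M.
  rewrite /wd; case: ifP => _; first exact: wW.
  by rewrite /width_bound /M; nia.
have w2 : wires l <= width_bound l * M.
  case: (nat_of_ord l) => [|l'] /=; last exact: w1.
  by rewrite /width_bound /M; nia.
have b1 : bd l <= size_bound l * M.
  rewrite /bd /size_bound /level_bound; move: w2; rewrite /M.
  set a := wires l; set b := width_bound l; set d := node_bound _ _ _.
  set e := _ * (terms_bound _ + _); nia.
by rewrite -mulnn mulnACA leq_mul.
Qed.

Lemma nuP_nuDet (L : language) : nuP A L -> nuDet (2 :: rev qs) L.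
Proof.
move=> [t [iota [S [[c hc] hL]]]].
(* A NuDFA rejects the empty word, so length 0 gets a circuit with constant output [false]. *)
have [D0 hD0] : exists D : lcircuit (2 :: rev qs) 0, forall x, lval D x (size qs) 0 = false.
  pose wd l := (l == size qs) : nat.
  have [| |l j _ _|D [_ vD]] := @lcircuit_exists (2 :: rev qs) 0 wd
    (fun l => gate_size (projT1 (cid (constant_gate (nth 0 (rev (2 :: rev qs)) l) 0))))
    (fun _ _ _ => false).
  - by [].
  - by rewrite /= size_rev /wd eqxx.
  - case: (cid _) => g [h1 h2] /=; exists g; split=> // e'.
    by have := h1 e'.
  by exists D => x; have := vD x; rewrite /= size_rev.
pose e := total_bound * (1 + 2 * c) ^ 2.
(* One number serves as factor, exponent and summand: it dominates [e], the exponent [c.+1 * 2] and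
   the size of [D0]. *)
exists (e + 2 * c + 2 + lsize D0) => n.
case: n => [|n].
  exists D0; split; first by rewrite -[lsize D0]add0n; apply: leq_add => //; apply: leq_addl.
  move=> w w0; rewrite /lout /= size_rev hD0; split=> //.
  by move/hL => []; rewrite w0.
have [D [sD vD]] := nuDet_simulation (cbody (t n.+1)) iota S.
exists D; split.
  apply: leq_trans sD _; apply: leq_trans (leq_addr _ _).
  set M := cnodes _.
  have hM : M.+1 <= 2 * c * n.+1 ^ c.
    apply: leq_trans (_ : c * n.+1 ^ c + c <= _); last first.
      have : 0 < n.+1 ^ c by rewrite expn_gt0.
      nia.
    by apply: leq_trans (hc n.+1 isT); rewrite /circuit_size leq_addr.
  have h1 : n.+1 + M.+1 <= (1 + 2 * c) * n.+1 ^ c.+1.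
    have : n.+1 ^ c <= n.+1 ^ c.+1 by rewrite leq_pexp2l.
    have : n.+1 <= n.+1 ^ c.+1 by rewrite -{1}[n.+1]expn1 leq_pexp2l.
    nia.
  apply: leq_trans (_ : e * n.+1 ^ (c.+1 * 2) <= _).
    by rewrite /e -mulnA expnM -expnMn leq_mul2l leq_exp2r // h1 orbT.
  apply: leq_mul; first by rewrite -!addnA leq_addr.
  by apply: leq_pexp2l => //; lia.
move=> w wn; rewrite hL /lout /nudfa_accepts /= size_rev vD wn /circuit_eval.
rewrite (tnth_nth (iota false)); split=> [[]|] //.
Qed.

End Assembly.

Theorem mainTheorem9 (A : finAlgebra) :
  solvable_algebra A -> has_malcev_term A ->
  exists ps : seq nat, (0 < size ps)%N /\ all prime ps /\
    forall L : language, nuP A L -> nuDet ps L.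
Proof.
move=> sol mal; have [qs [pqs inj]] := injective_levels sol mal.
exists (2 :: rev qs); split=> //; split; first by rewrite /= all_rev.
exact: nuP_nuDet inj.
Qed.
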